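(* For every integer $k\ge2$ there is a finite total concept class $C_k$ (that is, a finite set $X_k$ and a set $C_k\subseteq\{\pm1\}^{X_k}$) with $$\mathrm{VC}(C_k)=2\qquad\text{and}\qquad s_{\min}(C_k)\ge k.$$
   Context: For $\mathcal{C}\subseteq\{\pm1\}^{\mathcal{X}}$ with $\mathcal{X}$ finite, a set $S\subseteq\mathcal{X}$ is shattered by $\mathcal{C}$ if $\{c|_S:c\in\mathcal{C}\}=\{\pm1\}^S$, and $\mathrm{VC}(\mathcal{C})$ is the size of the largest shattered set. For $h\in\{\pm1\}^{\mathcal{X}}$, $s_h(\mathcal{C})$ is the largest $m\ge0$ for which there exist distinct points $x_1,\dots,x_m\in\mathcal{X}$ and concepts $c_0,c_1,\dots,c_m\in\mathcal{C}$ such that $c_i(x_j)=h(x_j)\iff i\ne j$ for every $i\in\{0,\dots,m\}$ and $j\in[m]$. The minimum star number is $s_{\min}(\mathcal{C})=\min_{h\in\{\pm1\}^{\mathcal{X}}}s_h(\mathcal{C})$. *)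

(* Defs.v *)
From mathcomp Require Import all_boot.

Set Implicit Arguments.
Unset Strict Implicit.
Unset Printing Implicit Defensive.

(* {±1}^X, with the two signs encoded as the two booleans; only equality of
   values is ever used. *)
Notation concept X := {ffun X -> bool}.

Definition restrict (X : finType) (S : {set X}) (c : concept X) :
    concept {x : X | x \in S} :=
  [ffun x => c (val x)].

Definition shattered (X : finType) (C : {set concept X}) (S : {set X}) : bool :=
  restrict S @: C == [set: concept {x : X | x \in S}].

(* The maximum over an empty family is 0, so VC set0 = 0. *)
Definition VC (X : finType) (C : {set concept X}) : nat :=
  \max_(S : {set X} | shattered C S) #|S|.

(* The points x_1, ..., x_m are stored 0-based: x_(j+1) is [x j] with j : 'I_m,
   while c_0, ..., c_m keep their indices; hence the test i != j.+1. *)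
Definition has_star (X : finType) (C : {set concept X}) (h : concept X)
    (m : nat) : bool :=
  [exists x : {ffun 'I_m -> X}, exists c : {ffun 'I_m.+1 -> concept X},
    [&& injectiveb x,
        [forall i, c i \in C]
      & [forall i, forall j, (c i (x j) == h (x j)) == (i != j.+1 :> nat)]]].

(* The points of a star are distinct, so m <= #|X| loses nothing
   (has_star_leq_card). The value is 0 when C is empty. *)
Definition star_number (X : finType) (C : {set concept X}) (h : concept X) : nat :=
  \max_(m < #|X|.+1 | has_star C h m) m.

(* The constant concept only witnesses that the range of h is nonempty. *)
Definition min_star_number (X : finType) (C : {set concept X}) : nat :=
  star_number C [arg min_(h < [ffun=> true] : concept X) star_number C h].

Lemma has_star_leq_card (X : finType) (C : {set concept X}) (h : concept X) m :
  has_star C h m -> m <= #|X|.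
Proof.
move=> /existsP[x /existsP[c /and3P[/injectiveP x_inj _ _]]].
by rewrite -[m]card_ord; apply: leq_card x_inj.
Qed.

Lemma leq_star_number (X : finType) (C : {set concept X}) (h : concept X) m :
  has_star C h m -> m <= star_number C h.
Proof.
move=> hm; have := has_star_leq_card hm; rewrite -ltnS => ltm.
exact: (@leq_bigmax_cond _ _ (fun i : 'I_#|X|.+1 => i : nat) (Ordinal ltm)).
Qed.

Lemma has_star_star_number (X : finType) (C : {set concept X}) (h : concept X) :
  C != set0 -> has_star C h (star_number C h).
Proof.
case/set0Pn=> c0 c0C; rewrite /star_number.
have h0 : has_star C h (ord0 : 'I_#|X|.+1).
  apply/existsP; exists (finfun (fun i : 'I_0 => match i with Ordinal _ p =>
     False_rect X (notF p) end)).
  apply/existsP; exists [ffun=> c0]; apply/and3P; split.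
  - by apply/injectiveP; case.
  - by apply/forallP=> i; rewrite ffunE.
  - by apply/forallP=> i; apply/forallP; case.
pose P (i : 'I_#|X|.+1) := has_star C h i.
by rewrite (@bigmax_eq_arg _ ord0 P (fun i => i : nat) h0); case: arg_maxnP.
Qed.

Lemma min_star_numberP (X : finType) (C : {set concept X}) k :
  reflect (forall h, k <= star_number C h) (k <= min_star_number C).
Proof.
rewrite /min_star_number; case: arg_minnP => // h _ min_h.
by apply: (iffP idP) => [kh h'|]; [apply: leq_trans kh (min_h _ _) | apply].
Qed.

(* Main.v *)
(** The points 1, ..., 2^k - 1 are the in-order numbering of the nodes of a
    binary tree in which the height of [v] is its 2-adic valuation, and the leaf
    [l] sits between the nodes [l] and [l + 1]; the point 0 is mere padding. The
    concepts are the initial segments {x | x <= l}, together with those obtained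
    by flipping one such segment at an ancestor of the leaf [l].

    Any [h] steers a binary search: at the node [v], go right iff [h v]. If the
    search ends at [l], the segment of [l] agrees with [h] on the k visited
    nodes, all of them ancestors of [l], so these nodes form a star around [h].

    For a < b < c, the pattern 001 arises only by flipping at [c] the segment of
    some l < a, and 011 only by flipping at [a] the segment of some l >= c. Then
    [c] would be higher than [a] and [a] higher than [c], so no three points are
    shattered. *)
Require Import Defs.
From mathcomp Require Import all_boot.
From mathcomp Require Import zify.

Set Implicit Arguments.
Unset Strict Implicit.
Unset Printing Implicit Defensive.

(** Any pattern on [S] extends to a total function, so the subtype can be avoided. *)
Lemma shatteredP (X : finType) (C : {set concept X}) (S : {set X}) :
  reflect (forall f : concept X, exists2 c, c \in C & {in S, c =1 f})
          (shattered C S).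
Proof.
apply: (iffP eqP) => [shS f | shS].
  have : restrict S f \in restrict S @: C by rewrite shS inE.
  case/imsetP=> c cC eq_fc; exists c => // x xS.
  by have /ffunP/(_ (exist _ x xS)) := eq_fc; rewrite !ffunE.
apply/setP=> g; rewrite inE; apply/imsetP.
have [c cC eq_cg] := shS [ffun x => oapp g true (insub x)].
exists c => //; apply/ffunP=> x.
by rewrite ffunE eq_cg ?(valP x) // ffunE valK.
Qed.

Section TreeClass.

Variable N : nat.
Implicit Types (l u v x : 'I_N) (o : option 'I_N).

(* Every node between a leaf and an ancestor [v] of it is a proper descendant
   of [v], hence lower. *)
Definition ancestor v l : bool :=
  [forall u : 'I_N, (l < u < v) || (v < u <= l) ==> (logn 2 u < logn 2 v)].

Definition segment l o : concept 'I_N :=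
  [ffun x : 'I_N => (x <= l) (+) (Some x == o)].

Definition tree_class : {set concept 'I_N} :=
  [set segment p.1 p.2 | p : 'I_N * option 'I_N
                       & oapp (ancestor^~ p.1) true p.2].

Lemma segment_tree_class l o :
  oapp (ancestor^~ l) true o -> segment l o \in tree_class.
Proof. by move=> lo; apply/imsetP; exists (l, o); rewrite ?inE. Qed.

Lemma tree_class_no_triple (S : {set 'I_N}) a b c :
    shattered tree_class S -> a \in S -> b \in S -> c \in S ->
  a < b -> b < c -> False.
Proof.
move=> /shatteredP shS aS bS cS ab bc.
have [_ /imsetP[[l o] /[!inE] /= anc_o ->] f1] := shS [ffun x => x == c].
have [_ /imsetP[[m q] /[!inE] /= anc_q ->] f2] := shS [ffun x => x != a].
have ac := ltn_trans ab bc.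
(* Without a flip at [c], the segment contains [c], hence also [a] and [b]; both would have to be
   the flipped point. *)
have eo : o = Some c.
  move: (f1 a aS) (f1 b bS) (f1 c cS); rewrite !ffunE eqxx.
  rewrite -!val_eqE /= (ltn_eqF ac) (ltn_eqF bc).
  case: (eqVneq (Some c) o) => [-> //|_]; rewrite addbF => + + cl.
  rewrite (ltnW (leq_trans ac cl)) (ltnW (leq_trans bc cl)) /=.
  move=> /negbFE/eqP <- /negbFE/eqP [eba].
  by rewrite eba ltnn in ab.
have eqa : q = Some a.
  move: (f2 a aS) (f2 b bS) (f2 c cS); rewrite !ffunE eqxx.
  rewrite -!val_eqE /= (gtn_eqF ac) (gtn_eqF ab) /=.
  case: (eqVneq (Some a) q) => [-> //|_]; rewrite addbF leqNgt => /negbFE la.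
  rewrite (leqNgt b) (leqNgt c) (ltn_trans la ac) (ltn_trans la ab) /=.
  move=> /eqP <- /eqP [ecb].
  by rewrite ecb ltnn in bc.
have la : l < a.
  move: (f1 a aS); rewrite !ffunE eo -!val_eqE /= (ltn_eqF ac).
  by rewrite (inj_eq Some_inj) -val_eqE /= (ltn_eqF ac) addbF ltnNge => ->.
have cm : c <= m.
  move: (f2 c cS); rewrite !ffunE eqa (inj_eq Some_inj) -!val_eqE /=.
  by rewrite (gtn_eqF ac) addbF.
move: anc_o anc_q; rewrite eo eqa /= => /forallP/(_ a) + /forallP/(_ c).
rewrite la ac cm orbT /= => ltac ltca.
by have := ltn_trans ltac ltca; rewrite ltnn.
Qed.

Lemma VC_tree_class_le2 : VC tree_class <= 2.
Proof.
apply/bigmax_leqP=> S shS; rewrite leqNgt; apply/negP.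
case/card_gt2P=> x [y [z [[xS yS zS] [xy yz zx]]]].
have no := tree_class_no_triple shS.
move: xy yz zx; rewrite -!val_eqE /=.
by case: (ltngtP x y) => // ?; case: (ltngtP y z) => // ?;
  case: (ltngtP z x) => // ?; eauto; lia.
Qed.

(** A point of valuation at least [n] in the open window is [lo + q * 2 ^ n] with [0 < q < 2], hence
    the midpoint. *)
Lemma logn2_lt_mid (n lo u : nat) :
    2 ^ n.+1 %| lo -> lo < u < lo + 2 ^ n.+1 -> u != lo + 2 ^ n ->
  logn 2 u < logn 2 (lo + 2 ^ n).
Proof.
move=> dlo ulo umid; have n0 : 0 < 2 ^ n by rewrite expn_gt0.
have dn : 2 ^ n %| lo by apply: dvdn_trans dlo; rewrite dvdn_exp2l.
have e2 : 2 ^ n.+1 = 2 ^ n + 2 ^ n by rewrite expnS mul2n addnn.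
apply: (@leq_trans n); last by rewrite -pfactor_dvdn ?dvdn_addr //; lia.
rewrite ltnNge -pfactor_dvdn //; last by lia.
rewrite -(subnKC (ltnW (proj1 (andP ulo)))) dvdn_addr //.
apply/negP=> /dvdnP[q eq_q]; have : 0 < q < 2 by nia.
by case: q eq_q => [|[|q]] //; lia.
Qed.

(** Induction on the height [n] of the subtree with leaves in [[lo, lo + 2 ^ n)]; [s] lists the
    visited nodes. *)
Lemma binary_search (h : concept 'I_N) n lo :
    2 ^ n %| lo -> lo + 2 ^ n <= N ->
  exists (l : 'I_N) (s : n.-tuple 'I_N),
    [/\ lo <= l < lo + 2 ^ n, uniq s
      & forall x, x \in s ->
          [/\ lo < x < lo + 2 ^ n, h x = (x <= l) & ancestor x l]].
Proof.
elim: n lo => [|n IHn] lo dlo leN.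
  have ltN : lo < N by rewrite -addn1.
  by exists (Ordinal ltN), [tuple]; split=> //=; rewrite leqnn addn1 /=.
have n0 : 0 < 2 ^ n by rewrite expn_gt0.
have dn : 2 ^ n %| lo by apply: dvdn_trans dlo; rewrite dvdn_exp2l.
have e2 : 2 ^ n.+1 = 2 ^ n + 2 ^ n by rewrite expnS mul2n addnn.
have midN : lo + 2 ^ n < N by lia.
pose mid := Ordinal midN.
pose lo' := if h mid then lo + 2 ^ n else lo.
have dlo' : 2 ^ n %| lo' by rewrite /lo'; case: ifP; rewrite ?dvdn_addl.
have leN' : lo' + 2 ^ n <= N by rewrite /lo'; case: ifP; lia.
have [l [s [l_in s_uniq sP]]] := IHn lo' dlo' leN'.
have sub u : lo' <= u < lo' + 2 ^ n -> lo <= u < lo + 2 ^ n.+1.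
  by rewrite /lo'; case: ifP; lia.
have hmid : h mid = (mid <= l).
  by move: l_in; rewrite /lo' /=; case: (h mid); lia.
exists l, [tuple of mid :: s]; split.
- exact: sub.
(* [mid] is an endpoint of the chosen half, and the bounds on [s] are strict. *)
- rewrite /= s_uniq andbT; apply/negP=> /sP[] /= + _ _.
  by rewrite /lo'; case: ifP; lia.
- move=> x; rewrite inE => /predU1P[-> | /sP[x_in hx anc_x]]; last first.
    by split=> //; move: x_in; rewrite /lo'; case: ifP; lia.
  split=> //=; first by lia.
  have := sub _ l_in => l_in'.
  apply/forallP=> u; apply/implyP=> /= u_in.
  by apply: logn2_lt_mid; lia.
Qed.

Lemma tree_class_has_star (h : concept 'I_N) k :
  2 ^ k <= N -> has_star tree_class h k.
Proof.
move=> leN; have [l [s [_ s_uniq sP]]] := binary_search h (dvdn0 _) leN.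
have s_inj : injective (tnth s) by apply/tuple_uniqP.
apply/existsP; exists [ffun j => tnth s j].
(* Index 0 gives the unflipped segment, index [j.+1] its flip at the [j]-th visited node. *)
apply/existsP; exists [ffun i => segment l (omap (tnth s) (unlift ord0 i))].
apply/and3P; split.
- by apply/injectiveP=> i j; rewrite !ffunE => /s_inj.
- apply/forallP=> i; rewrite ffunE; apply: segment_tree_class.
  by case: (unlift _ i) => //= j; have [] := sP _ (mem_tnth j s).
apply/forallP=> i; apply/forallP=> j; rewrite !ffunE.
have [_ -> _] := sP _ (mem_tnth j s).
case: unliftP => [i'|] -> /=; last by rewrite addbF eqxx.
rewrite (inj_eq Some_inj) (inj_eq s_inj) /bump /= add1n eqSS
  -(val_eqE j) (eq_sym (val j)) /=.
by case: (_ <= l); case: (val i' == val j).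
Qed.

Lemma VC_tree_class_ge2 : 2 < N -> 2 <= VC tree_class.
Proof.
move=> N3; have N2 : 1 < N by lia. have N1 : 0 < N by lia.
pose a := Ordinal N2; pose b := Ordinal N3; pose z := Ordinal N1.
have <- : #|[set a; b]| = 2 by rewrite cards2.
apply: (@leq_bigmax_cond _ _ (fun S : {set 'I_N} => #|S|)).
apply/shatteredP=> f.
(* On the nodes 1 and 2, the leaves 0, 1, 2 give 00, 10, 11; flipping the segment of leaf 0 at 2
   gives 01. *)
exists (segment (if f a then if f b then b else a else z)
                (if ~~ f a && f b then Some b else None)).
  apply: segment_tree_class; case: (f a); case: (f b) => //=.
  apply/forallP=> u; apply/implyP=> /= u_in.
  by have -> : u = 1 :> nat by lia.
by move=> x /[!inE] /orP[] /eqP ->; rewrite ffunE; case: (f a); case: (f b).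
Qed.

End TreeClass.

Theorem theorem1p19 (k : nat) (hk : 2 <= k) :
  exists (X : finType) (C : {set concept X}),
    VC C = 2 /\ k <= min_star_number C.
Proof.
exists 'I_(2 ^ k), (tree_class (2 ^ k)); split.
  apply/eqP; rewrite eqn_leq VC_tree_class_le2 VC_tree_class_ge2 //.
  by apply: leq_trans (_ : 2 ^ 2 <= _) => //; rewrite leq_exp2l.
apply/min_star_numberP=> h; apply: leq_star_number.
exact: tree_class_has_star.
Qed.
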